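(* Let $d\ge1$ and let $K:\mathbb{R}_*^d\times\mathbb{R}_*^d\to[0,\infty)$ be continuous and symmetric. Suppose that there are $c_2\in(0,\infty)$, $\beta\in\mathbb{R}$ and $\gamma=(\gamma_1,\gamma_2),\lambda=(\lambda_1,\lambda_2)\in\mathbb{R}^2$ with $-\lambda_j\le\gamma_j+\lambda_j$ and $\gamma_j+\lambda_j<1$ for $j=1,2$, such that for all $x,y\in\mathbb{R}_*^d$ with $|y|\le|x|$, $$K(x,y)\le c_2\begin{cases}|x|^{-\beta}|y|^{-\beta}, & |x|,|y|\le1,\\ |x|^{\gamma_1+\lambda_1}|y|^{-\lambda_1}, & |x|\ge1,\ |y|\le1,\\ |x|^{\gamma_2+\lambda_2}|y|^{-\lambda_2}, & |x|,|y|\ge1.\end{cases}$$ Suppose that $n_0:\mathbb{N}_0^d\setminus\{0\}\to[0,\infty)$ satisfies $\sum_{\alpha>0}|\alpha|n_0(\alpha)<\infty$. Then there exists a strong solution $n:(\mathbb{N}_0^d\setminus\{0\})\times[0,\infty)\to[0,\infty)$ of the discrete coagulation equation with $n(\cdot,0)=n_0$; that is, for every $\alpha\in\mathbb{N}_0^d\setminus\{0\}$ the map $t\mapsto n(\alpha,t)$ is continuously differentiable, and for all $t\ge0$ and $\alpha\in\mathbb{N}_0^d\setminus\{0\}$, $$\partial_t n(\alpha,t)=\frac12\sum_{\beta'<\alpha}K(\alpha-\beta',\beta')n(\beta',t)n(\alpha-\beta',t)-n(\alpha,t)\sum_{\beta'>0}K(\alpha,\beta')n(\beta',t).$$ Moreover,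 for all $t\ge0$, $$\sum_{\alpha>0}\alpha\, n(\alpha,t)\le\sum_{\alpha>0}\alpha\, n_0(\alpha)\quad\text{and}\quad\sup_{s\in[0,t]}\sum_{\alpha>0}\omega(\alpha)n(\alpha,s)<\infty.$$
   Context: $\mathbb{N}_0=\{0,1,2,\dots\}$, $\mathbb{R}_*^d=[0,\infty)^d\setminus\{0\}$, $|x|=\sum_{j=1}^d|x_j|$. For vectors $a,b\in\mathbb{R}^d$, $a\le b$ means $a_k\le b_k$ for all $k$, and $a<b$ means $a\le b$ and $a\ne b$. All summation indices range over $\mathbb{N}_0^d\setminus\{0\}$ (so $\sum_{\alpha>0}$ is the sum over all $\alpha\in\mathbb{N}_0^d\setminus\{0\}$, and $\sum_{\beta'<\alpha}$ is over $\beta'\in\mathbb{N}_0^d\setminus\{0\}$ with $\beta'<\alpha$). The weight is $\omega(x)=|x|^{\min(-\beta,-\lambda_1)}$ if $|x|\le1$, and $\omega(x)=|x|^{\max(\gamma_1+\lambda_1,\gamma_2+\lambda_2)}$ if $|x|>1$. *)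

(* Defs.v *)
From HB Require Import structures.
From mathcomp Require Import all_boot all_order all_algebra.
From mathcomp Require Import all_classical all_reals all_analysis.

Set Implicit Arguments.
Unset Strict Implicit.
Unset Printing Implicit Defensive.

Import Order.TTheory GRing.Theory Num.Theory.
Import numFieldNormedType.Exports.

Local Open Scope classical_set_scope.
Local Open Scope ring_scope.

Section Space.
Context {R : realType} {d : nat}.
Implicit Types (x : 'rV[R]_d) (a b : 'rV[nat]_d).

Definition orthant : set 'rV[R]_d := [set x | (forall j, 0 <= x 0 j) /\ x != 0].

Definition l1norm x : R := \sum_(j < d) `|x 0 j|.

Definition multi_index : set 'rV[nat]_d := [set a | a != 0].

Definition vec a : 'rV[R]_d := map_mx (fun k : nat => k%:R) a.

Definition mi_le a b : Prop := forall j, (a ord0 j <= b ord0 j)%N.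

Definition mi_lt a b : Prop := mi_le a b /\ a != b.

(* Subtraction of natural numbers is truncated, so this is the difference of
   the vectors only when [mi_le b a]. *)
Definition mi_sub a b : 'rV[nat]_d := map2_mx subn a b.

Definition kernel_bound (c beta : R) (gamma lambda : R * R)
    (K : 'rV[R]_d -> 'rV[R]_d -> R) : Prop :=
  forall x y, orthant x -> orthant y -> l1norm y <= l1norm x ->
  [/\ l1norm x <= 1 -> l1norm y <= 1 ->
        K x y <= c * (l1norm x `^ (- beta) * l1norm y `^ (- beta)),
      1 <= l1norm x -> l1norm y <= 1 ->
        K x y <= c * (l1norm x `^ (gamma.1 + lambda.1)
                      * l1norm y `^ (- lambda.1))
    & 1 <= l1norm x -> 1 <= l1norm y ->
        K x y <= c * (l1norm x `^ (gamma.2 + lambda.2)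
                      * l1norm y `^ (- lambda.2))].

Definition weight (beta : R) (gamma lambda : R * R) x : R :=
  if l1norm x <= 1 then l1norm x `^ Num.min (- beta) (- lambda.1)
  else l1norm x `^ Num.max (gamma.1 + lambda.1) (gamma.2 + lambda.2).

(* The difference quotient is restricted to [A], so at an endpoint of an
   interval [A] this is the one-sided derivative. *)
Definition has_derive_within (A : set R) (f : R -> R) (t l : R) : Prop :=
  (f s - f t) / (s - t) @[s --> within A t^'] --> l.

Definition gain (K : 'rV[R]_d -> 'rV[R]_d -> R) (u : 'rV[nat]_d -> R) a : R :=
  \sum_(b \in [set b | multi_index b /\ mi_lt b a])
    (K (vec (mi_sub a b)) (vec b) * u b * u (mi_sub a b)).

Definition loss (K : 'rV[R]_d -> 'rV[R]_d -> R) (u : 'rV[nat]_d -> R) a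
    : \bar R :=
  \esum_(b in multi_index) (K (vec a) (vec b) * u b)%:E.

(* The convergence of the loss series is required explicitly: in [\bar R] we
   have [0 * +oo = 0], so the equation alone would allow it to diverge
   where [n a t = 0]. *)
Definition strong_solution (K : 'rV[R]_d -> 'rV[R]_d -> R)
    (n : 'rV[nat]_d -> R -> R) : Prop :=
  forall a, multi_index a ->
  (forall t : R, 0 <= t -> 0 <= n a t) /\
  exists dn : R -> R,
    {within `[0, +oo[, continuous dn} /\
    forall t : R, 0 <= t ->
      [/\ has_derive_within `[0, +oo[ (n a) t (dn t),
          (loss K (n ^~ t) a < +oo)%E
        & (dn t)%:E = ((2^-1 * gain K (n ^~ t) a)%:E
                       - (n a t)%:E * loss K (n ^~ t) a)%E].

End Space.

(* Main.v *)
Require Import Defs.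
From mathcomp Require Import all_boot all_order all_algebra.
From mathcomp Require Import all_classical all_reals all_analysis.
From mathcomp Require Import ring lra.

Set Implicit Arguments.
Unset Strict Implicit.
Unset Printing Implicit Defensive.

Import Order.TTheory GRing.Theory Num.Theory.
Import numFieldNormedType.Exports.

Local Open Scope classical_set_scope.
Local Open Scope ring_scope.

(** Only nonzero integer vectors matter, and these have |a| >= 1. The third
case of the kernel bound, with the larger vector in the first place, gives
K(a,b) <= C_a |b|^(gamma_2 + lambda_2) for |b| > |a|. As that exponent is
smaller than 1, K is sublinear: for each fixed a, K(a,b) = o(|b|) as |b| tends
to infinity ([kernel_bound_sublinear]). Moreover the weight is at most |a|
([weight_le]), so the weighted sums are bounded by the mass sum_a |a| n(a,t).
It remains to solve the equation for a sublinear kernel without increasing any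
moment sum_a w(a) n(a,t) with w additive and nonnegative.

Truncate to the finite box of the nonzero a with entries at most N, dropping
the losses to partners outside the box, and discretise time by the explicit
Euler scheme with a step h_N tending to 0, so small that densities stay
nonnegative. Coagulation preserves additive weights, except that clusters
leaving the box are lost; so no such moment increases ([moment_rate_le0]), and
the scheme lives on states whose mass is at most that of n0.

On states of mass at most m, the rate of change of n(a) is bounded by a
constant that depends on a and m only ([rate_bounded]), and it is uniformly
continuous for the pointwise topology, uniformly in N
([rate_equicontinuous]): by sublinearity, the partners b outside a large box
contribute at most a small multiple of their mass to the loss. Consequently
the Euler densities are Lipschitz in time, their rates are equicontinuous in
time, and over p steps with p h_N <= delta(e) the increment differs from
p h_N times the initial rate by at most e p h_N ([euler_taylor]). All constants
are uniform in N.

Let N tend to infinity along a nonprincipal ultrafilter. The densities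
converge for all a and all t at once, with no extraction of subsequences. The
rates converge to the right-hand side of the equation for the limit
([limit_rate_cvg]), again because the tails of the loss series are uniformly
small. The Taylor estimate passes to the limit, uniformly on [0, +oo[, which
yields differentiability and the continuity of the derivative
([limit_taylor], [limit_rate_uniform]). Every moment of the limit is at most
the initial one, since its partial sum over each box is ([limit_moment]). *)

(** * Multi-indices and boxes *)

Section Indices.
Context {d : nat}.
Implicit Types (a b c : 'rV[nat]_d) (N M : nat).

(** A finite exhaustion of the index set by sets that contain the nonzero
summands of their members, so that the gain at a point of a box only involves
this box. *)
Definition box N : seq 'rV[nat]_d :=
  [seq a <- [seq map_mx (@nat_of_ord N.+1) x | x : 'rV['I_N.+1]_d] | a != 0].

Lemma mem_box N a : (a \in box N) = (a != 0) && [forall j, (a ord0 j <= N)%N].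
Proof.
rewrite mem_filter; congr (_ && _); apply/mapP/forallP => [[x _ ->] j|aN].
  by rewrite mxE -ltnS.
exists (map_mx inord a); first by rewrite mem_enum.
 apply/rowP => j; rewrite !mxE inordK //.
by rewrite ltnS aN.
Qed.

Lemma box_uniq N : uniq (box N).
Proof.
apply: filter_uniq; rewrite map_inj_uniq ?enum_uniq // => x y /rowP xy.
by apply/rowP => j; apply: val_inj; have := xy j; rewrite !mxE.
Qed.

Lemma box_neq0 N a : a \in box N -> a != 0.
Proof. by rewrite mem_box => /andP[]. Qed.

Lemma box_le M N a : (M <= N)%N -> a \in box M -> a \in box N.
Proof.
move=> MN; rewrite !mem_box => /andP[-> /forallP aM] /=.
by apply/forallP => j; apply: leq_trans MN.
Qed.

Definition mi_deg a : nat := (\sum_j a ord0 j)%N.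

Lemma deg_gt0 a : a != 0 -> (0 < mi_deg a)%N.
Proof.
apply: contraNltn; rewrite leqn0 /mi_deg sum_nat_eq0 => /forallP a0.
by apply/eqP/rowP => j; rewrite mxE; apply/eqP/(implyP (a0 j)).
Qed.

Lemma box_deg N a : a != 0 -> (mi_deg a <= N)%N -> a \in box N.
Proof.
rewrite mem_box => -> aN /=; apply/forallP => j; apply: leq_trans aN.
by rewrite /mi_deg (bigD1 j) //= leq_addr.
Qed.

Lemma notin_box N a : a != 0 -> a \notin box N -> (N < mi_deg a)%N.
Proof. by move=> a0; apply: contraNltn => /(box_deg a0). Qed.

Lemma degD a b : mi_deg (a + b) = (mi_deg a + mi_deg b)%N.
Proof. by rewrite /mi_deg -big_split /=; apply: eq_bigr => j _; rewrite !mxE. Qed.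

Lemma box_addl N a b : a != 0 -> a + b \in box N -> a \in box N.
Proof.
move=> a0; rewrite !mem_box a0 => /andP[_ /forallP abN] /=.
by apply/forallP => j; apply: leq_trans (abN j); rewrite !mxE leq_addr.
Qed.

Lemma box_addr N a b : b != 0 -> a + b \in box N -> b \in box N.
Proof. by rewrite addrC; exact: box_addl. Qed.

Lemma finite_sub_box (A : set 'rV[nat]_d) : finite_set A -> A `<=` multi_index ->
  exists N, A `<=` [set` box N].
Proof.
move=> /finite_seqP[s ->]; elim: s => [|a s IH] sm; first by exists 0%N.
have [|N sN] := IH; first by move=> x xs; apply: sm; rewrite /= inE xs orbT.
exists (maxn N (mi_deg a)) => x; rewrite /= inE => /predU1P[->|xs].
  by apply: box_deg; [apply: sm; rewrite /= mem_head | exact: leq_maxr].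
by apply: (box_le (leq_maxl _ _)); apply: sN.
Qed.

End Indices.

Section Sums.
Context {R : realType} {d : nat}.
Implicit Types (a b c : 'rV[nat]_d) (N M : nat) (f : 'rV[nat]_d -> R).

Lemma l1norm_vec a : l1norm (vec a) = (mi_deg a)%:R :> R.
Proof.
by rewrite /l1norm natr_sum; apply: eq_bigr => j _; rewrite !mxE ger0_norm.
Qed.

Lemma orthant_vec a : multi_index a -> orthant (vec a : 'rV[R]_d).
Proof.
move=> a0; split=> [j|]; first by rewrite mxE.
apply/eqP => va; move/eqP: a0; apply; apply/rowP => j.
(* The condition x != 0 of an orthant compares coordinate functions, so [va]
   rewrites the function applied to 0 and j. *)
have /eqP : (vec a : 'rV[R]_d) 0 j = 0 by rewrite va.
by rewrite !mxE pnatr_eq0 => /eqP.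
Qed.

Lemma sum_box_sub M N f : (M <= N)%N ->
  \sum_(a <- box N | a \in box M) f a = \sum_(a <- box M) f a.
Proof.
move=> MN; rewrite -big_filter; apply: perm_big; apply: uniq_perm.
- by apply: filter_uniq; exact: box_uniq.
- exact: box_uniq.
- by move=> a; rewrite mem_filter andb_idr //; exact: box_le.
Qed.

Lemma sum_box_le M N f : (M <= N)%N -> (forall a, a \in box N -> 0 <= f a) ->
  \sum_(a <- box M) f a <= \sum_(a <- box N) f a.
Proof.
move=> MN f0; rewrite [leRHS](bigID (mem (box M))) /= sum_box_sub //.
by rewrite lerDl big_seq_cond sumr_ge0 // => a /andP[/f0].
Qed.

Lemma le_sum_box N f a : (forall b, b \in box N -> 0 <= f b) -> a \in box N ->
  f a <= \sum_(b <- box N) f b.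
Proof.
move=> f0 aN; rewrite (bigD1_seq a) ?box_uniq //= lerDl.
by rewrite big_seq_cond sumr_ge0 // => b /andP[/f0].
Qed.

Lemma box_le_esum N f : (forall a, multi_index a -> 0 <= f a) ->
  ((\sum_(a <- box N) f a)%:E <= \esum_(a in multi_index) (f a)%:E)%E.
Proof.
move=> f0; rewrite -sumEFin fsbig_seq ?box_uniq //; apply: ereal_sup_ubound.
exists [set` box N] => //; split; first exact: finite_seq.
by move=> a /box_neq0.
Qed.

(** Every finite set of indices lies in a box, so that box sums suffice to
bound an unordered sum. *)
Lemma esum_le_box (C : \bar R) f : (forall a, multi_index a -> 0 <= f a) ->
  (forall N, ((\sum_(a <- box N) f a)%:E <= C)%E) ->
  (\esum_(a in multi_index) (f a)%:E <= C)%E.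
Proof.
move=> f0 fC; apply: ub_ereal_sup => _ [A [finA Am] <-].
have [N AN] := finite_sub_box finA Am; apply: le_trans (fC N).
rewrite -sumEFin [leRHS]fsbig_seq ?box_uniq //.
apply: lee_fsum_nneg_subset => //=.
- exact: finite_seq.
- by move=> a; rewrite !inE => /AN.
- move=> a; rewrite !inE => /andP[_ /set_mem/box_neq0/f0].
  by rewrite lee_fin.
Qed.

(** For b < a the vector c = a - b is the only one with b + c = a. The double
sum makes the exchange of the two colliding clusters visible, which the moment
computation needs, and no longer has a range that depends on a. *)
Lemma gain_box K (u : 'rV[nat]_d -> R) N a : a \in box N ->
  gain K u a = \sum_(b <- box N) \sum_(c <- box N)
    (b + c == a)%:R * (K (vec c) (vec b) * u b * u c).
Proof.
move=> aN; rewrite [RHS](bigID (fun b => `[< mi_lt b a >])) /=.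
rewrite [X in _ + X]big1_seq ?addr0; last first.
  move=> b /andP[/asboolPn ba bN]; apply: big1_seq => c /andP[_ cN].
  case: eqP => [bca|]; last by rewrite mul0r.
  exfalso; apply: ba; split=> [j|]; first by rewrite -bca !mxE leq_addr.
  rewrite -bca; apply: contraNneq (box_neq0 cN) => /rowP bbc; apply/eqP/rowP => j.
  by have /eqP := bbc j; rewrite !mxE -[X in X == _]addn0 eqn_add2l => /eqP <-.
rewrite -[RHS]big_filter [RHS]fsbig_seq; last first.
  by apply: filter_uniq; exact: box_uniq.
rewrite /gain.
have -> : [set b | multi_index b /\ mi_lt b a] =
    [set` [seq b <- box N | `[< mi_lt b a >]]].
  apply/seteqP; split=> b /=; rewrite mem_filter.
    move=> [b0 ba]; rewrite asboolT //=; move: aN; rewrite !mem_box b0 /=.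
    move=> /andP[_ /forallP aN]; apply/forallP => j.
    by apply: leq_trans (ba.1 j) _.
  by move=> /andP[/asboolP ? /box_neq0].
apply: eq_fsbigr => b; rewrite inE /= mem_filter => /andP[/asboolP [ba bna] bN].
have bac : b + mi_sub a b = a by apply/rowP => j; rewrite !mxE; exact: subnKC.
have c0 : mi_sub a b != 0.
  by apply: contraNneq bna => c0; rewrite -bac c0 addr0.
have cN : mi_sub a b \in box N by apply: (box_addr (a := b)); rewrite // bac.
rewrite (bigD1_seq (mi_sub a b)) ?box_uniq //= bac eqxx mul1r.
rewrite big1 ?addr0 // => c /eqP cab.
case: eqP => [bca|]; last by rewrite mul0r.
by case: cab; apply/rowP => j; rewrite -bca !mxE; exact/esym/addKn.
Qed.

End Sums.

(** * The truncated coagulation operator *)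

Section Rate.
Context {R : realType} {d : nat} (K : 'rV[R]_d -> 'rV[R]_d -> R).
Local Notation k a b := (K (vec a) (vec b)).
Implicit Types (a b c : 'rV[nat]_d) (N M : nat) (x y u w : 'rV[nat]_d -> R).

Definition outflow N u a : R := \sum_(b <- box N) k a b * u b.

Definition rate N u a : R := 2^-1 * gain K u a - u a * outflow N u a.

(** The set of states on which all estimates hold uniformly: nonnegative with
mass at most m on the box of size N; the values outside are left free. *)
Definition state (m : R) N u : Prop :=
  (forall b, b \in box N -> 0 <= u b) /\
  \sum_(b <- box N) (mi_deg b)%:R * u b <= m.

(** Since |a| >= 1, the mass dominates each density. *)
Lemma state_bound m N u a : state m N u -> a \in box N -> 0 <= u a <= m.
Proof.
move=> [u0 um] aN; rewrite u0 //=; apply: le_trans um.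
apply: (@le_trans _ _ ((mi_deg a)%:R * u a)).
  by rewrite ler_peMl ?u0 // ler1n; apply/deg_gt0/box_neq0/aN.
apply: (@le_sum_box _ _ N (fun b => (mi_deg b)%:R * u b)) => // b bN.
by rewrite mulr_ge0 // u0.
Qed.

Context (k_ge0 : forall a b, multi_index a -> multi_index b -> 0 <= k a b).
Context (k_sym : forall a b, multi_index a -> multi_index b -> k a b = k b a).

Lemma outflow_ge0 N u a : (forall b, b \in box N -> 0 <= u b) ->
  multi_index a -> 0 <= outflow N u a.
Proof.
move=> u0 a0; rewrite /outflow big_seq sumr_ge0 // => b bN.
by rewrite mulr_ge0 ?u0 // k_ge0 //; exact: box_neq0 bN.
Qed.

Lemma gain_ge0 N u a : (forall b, b \in box N -> 0 <= u b) ->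
  a \in box N -> 0 <= gain K u a.
Proof.
move=> u0 aN; rewrite (gain_box _ _ aN) big_seq sumr_ge0 // => b bN.
rewrite big_seq sumr_ge0 // => c cN; rewrite !mulr_ge0 ?u0 //.
by rewrite k_ge0 //; [exact: box_neq0 cN | exact: box_neq0 bN].
Qed.

(** Put P(b,c) = K(c,b) u(b) u(c), which is symmetric. The gain contributes
half the sum of (w(b) + w(c)) P(b,c) over the pairs of the box whose sum
remains in the box; by symmetry that is at most the sum of w(b) P(b,c) over all
pairs of the box, which is what the loss removes. *)
Lemma moment_rate_le0 N u w : (forall a b, w (a + b) = w a + w b) ->
  (forall a, 0 <= w a) -> (forall b, b \in box N -> 0 <= u b) ->
  \sum_(a <- box N) w a * rate N u a <= 0.
Proof.
move=> wD w0 u0; pose P b c := k c b * u b * u c.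
have P0 b c : b \in box N -> c \in box N -> 0 <= P b c.
  move=> bN cN; rewrite !mulr_ge0 ?u0 //.
  by rewrite k_ge0 //; [exact: box_neq0 cN | exact: box_neq0 bN].
have PC b c : b \in box N -> c \in box N -> P b c = P c b.
  move=> bN cN; rewrite /P k_sym; first by rewrite mulrAC.
    exact: box_neq0 cN.
  exact: box_neq0 bN.
pose S := \sum_(b <- box N) \sum_(c <- box N) w b * P b c.
have outE : \sum_(a <- box N) w a * (u a * outflow N u a) = S.
  apply: eq_big_seq => a aN; rewrite /outflow !mulr_sumr.
  apply: eq_big_seq => c cN.
  by rewrite PC // /P; ring.
have gainE : \sum_(a <- box N) w a * gain K u a =
    \sum_(b <- box N) \sum_(c <- box N) \sum_(a <- box N)
      (b + c == a)%:R * ((w b + w c) * P b c).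
  under eq_big_seq => a aN do rewrite (gain_box _ _ aN) mulr_sumr.
  rewrite exchange_big /=; apply: eq_bigr => b _.
  under eq_bigr => a _ do rewrite mulr_sumr.
  rewrite exchange_big /=; apply: eq_bigr => c _; apply: eq_bigr => a _.
  rewrite -wD; case: eqP => [->|_]; rewrite ?mul0r ?mulr0 ?mul1r //.
have S2 : \sum_(b <- box N) \sum_(c <- box N) (w b + w c) * P b c = S + S.
  under eq_bigr => b _ do under eq_bigr => c _ do rewrite mulrDl.
  under eq_bigr => b _ do rewrite big_split /=.
  rewrite big_split /=; congr (_ + _); rewrite exchange_big /=.
  by apply: eq_big_seq => c cN; apply: eq_big_seq => b bN; rewrite PC.
have gain_le : \sum_(a <- box N) w a * gain K u a <= S + S.
  rewrite gainE -S2 big_seq [leRHS]big_seq; apply: ler_sum => b bN.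
  rewrite big_seq [leRHS]big_seq; apply: ler_sum => c cN.
  rewrite -mulr_suml ler_piMl //; first by rewrite mulr_ge0 ?P0 ?addr_ge0.
  have [bcN|bcN] := boolP (b + c \in box N).
    rewrite (bigD1_seq (b + c)) ?box_uniq //= eqxx big1 ?addr0 // => a.
    by rewrite eq_sym => /negPf ->.
  by rewrite big1_seq // => a /= aN; case: eqP bcN => // ->; rewrite aN.
rewrite /rate; under eq_bigr => a _ do rewrite mulrBr.
rewrite sumrB outE; under eq_bigr => a _ do rewrite mulrCA.
rewrite -mulr_sumr; lra.
Qed.

Context (k_sublinear : forall a (e : R), multi_index a -> 0 < e ->
  exists M, forall b, multi_index b -> (M < mi_deg b)%N ->
    k a b <= e * (mi_deg b)%:R).

(** Beyond some M the bound K(a,b) <= |b| holds, and the finitely many other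
b, for which |b| >= 1, are absorbed in the constant. *)
Lemma linear_bound : exists A : 'rV[nat]_d -> R, forall a, multi_index a ->
  0 <= A a /\ forall b, multi_index b -> k a b <= A a * (mi_deg b)%:R.
Proof.
have/choice[A AP] a : exists A : R, multi_index a -> 0 <= A /\
    forall b, multi_index b -> k a b <= A * (mi_deg b)%:R; last by exists A.
have [a0|/negP a0] := boolP (a != 0); last by exists 0.
have [M kM] := k_sublinear a0 ltr01.
have kM0 b : b \in box M -> 0 <= k a b.
  by move=> bM; rewrite k_ge0 //; exact: box_neq0 bM.
exists (1 + \sum_(b <- box M) k a b) => _; split=> [|b b0].
  by rewrite addr_ge0 // big_seq sumr_ge0.
have b1 : 1 <= (mi_deg b)%:R :> R by rewrite ler1n deg_gt0.
have [bM|/(notin_box b0) bM] := boolP (b \in box M).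
  apply: (@le_trans _ _ (1 + \sum_(b <- box M) k a b)).
    by apply: le_trans (le_sum_box kM0 bM) _; rewrite lerDr.
  by rewrite ler_peMr // addr_ge0 // big_seq sumr_ge0.
apply: le_trans (kM b b0 bM) _; rewrite ler_wpM2r // lerDl.
by rewrite big_seq sumr_ge0.
Qed.

Lemma outflow_le (A m : R) N u a :
  (forall b, multi_index b -> k a b <= A * (mi_deg b)%:R) -> 0 <= A ->
  state m N u -> outflow N u a <= A * m.
Proof.
move=> kA A0 [u0 um]; apply: le_trans (ler_wpM2l A0 um).
rewrite mulr_sumr /outflow big_seq [leRHS]big_seq; apply: ler_sum => b bN.
by rewrite mulrA ler_wpM2r ?u0 // kA //; exact: box_neq0 bN.
Qed.

(** The gain is a finite sum that does not depend on N, and the loss is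
controlled by the mass through the linear bound on the kernel. *)
Lemma rate_bounded (m : R) : exists C : 'rV[nat]_d -> R, forall N u a,
  state m N u -> a \in box N -> `|rate N u a| <= C a.
Proof.
have [A AP] := linear_bound.
pose G a := \sum_(b <- box (mi_deg a)) \sum_(c <- box (mi_deg a)) k c b.
exists (fun a => 2^-1 * (G a * (m * m)) + m * (A a * m)) => N u a um aN.
have a0 := box_neq0 aN; have [A0 kA] := AP a a0.
have /andP[ua0 uam] := state_bound um aN.
have out0 := outflow_ge0 um.1 a0; have out1 := outflow_le kA A0 um.
have gain0 := gain_ge0 um.1 aN.
have gain1 : gain K u a <= G a * (m * m).
  have aa := box_deg a0 (leqnn _).
  rewrite (gain_box _ _ aa) mulr_suml big_seq [leRHS]big_seq.
  apply: ler_sum => b bT; rewrite mulr_suml big_seq [leRHS]big_seq.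
  apply: ler_sum => c cT.
  have k0 : 0 <= k c b.
    by rewrite k_ge0 //; [exact: box_neq0 cT | exact: box_neq0 bT].
  have m0 : 0 <= m by exact: le_trans uam.
  case: eqP => [bca|_]; last by rewrite mul0r !mulr_ge0.
  have bN : b \in box N.
    by apply: (box_addl (b := c)); [exact: box_neq0 bT | rewrite bca].
  have cN : c \in box N.
    by apply: (box_addr (a := b)); [exact: box_neq0 cT | rewrite bca].
  have /andP[? ?] := state_bound um bN; have /andP[? ?] := state_bound um cN.
  by rewrite mul1r -mulrA ler_wpM2l // ler_pM.
have prod1 : u a * outflow N u a <= m * (A a * m) by rewrite ler_pM.
have prod0 : 0 <= u a * outflow N u a by rewrite mulr_ge0.
by rewrite /rate ler_norml; apply/andP; split; lra.
Qed.

(** Sublinearity gives M such that K(a,b) <= e' |b| outside the box of size M.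
Those b contribute at most 2 e' m to the difference of the outflows, uniformly
in N, while the gain and the remaining part of the outflow are polynomials in
the finitely many densities of that box. *)
Lemma rate_equicontinuous (m e : R) a : multi_index a -> 0 <= m -> 0 < e ->
  exists M (eta : R), 0 < eta /\ forall N x y, (M <= N)%N ->
    state m N x -> state m N y ->
    (forall b, b \in box M -> `|x b - y b| <= eta) ->
    `|rate N x a - rate N y a| <= e.
Proof.
move=> a0 m0 e0; have [A /(_ a a0)[A0 kA]] := linear_bound.
(* With these e' and eta, each of the terms 2 e' m^2 and T eta of the final
   estimate is at most e / 2. *)
pose e' := e / (4 * (m * m + 1)).
have mm1 : 0 < m * m + 1 by have := mulr_ge0 m0 m0; lra.
have e'0 : 0 < e' by rewrite divr_gt0 // mulr_gt0.
have [M0 kM0] := k_sublinear a0 e'0.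
pose M := maxn M0 (mi_deg a).
have aM : a \in box M by rewrite box_deg // leq_maxr.
have kM b : multi_index b -> b \notin box M -> k a b <= e' * (mi_deg b)%:R.
  move=> b0 bM; apply: kM0 => //.
  by apply: leq_ltn_trans (notin_box b0 bM); exact: leq_maxl.
have kpos b c : b \in box M -> c \in box M -> 0 <= k c b.
  by move=> bM cM; rewrite k_ge0 //; [exact: box_neq0 cM | exact: box_neq0 bM].
pose kappa := \sum_(b <- box M) k a b.
pose G := \sum_(b <- box M) \sum_(c <- box M) k c b.
have kappa0 : 0 <= kappa.
  by rewrite /kappa big_seq sumr_ge0 // => b bM; exact: kpos.
have G0 : 0 <= G.
  rewrite /G big_seq sumr_ge0 // => b bM.
  by rewrite big_seq sumr_ge0 // => c cM; exact: kpos.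
pose T := G * m + m * kappa + A a * m.
have T0 : 0 <= T by rewrite /T !addr_ge0 // mulr_ge0.
pose eta := e / (2 * (T + 1)).
have eta0 : 0 < eta by rewrite divr_gt0 // mulr_gt0 //; lra.
exists M, eta; split=> // N x y MN xm ym xy.
have inN b : b \in box M -> b \in box N by exact: box_le.
have xB b (bM : b \in box M) := state_bound xm (inN b bM).
have yB b (bM : b \in box M) := state_bound ym (inN b bM).
have out_le : `|outflow N x a - outflow N y a| <= kappa * eta + e' * (m + m).
  apply: (@le_trans _ _ (\sum_(b <- box N) ((b \in box M)%:R * k a b * eta
      + e' * ((mi_deg b)%:R * x b + (mi_deg b)%:R * y b)))).
    rewrite /outflow -sumrB; apply: le_trans (ler_norm_sum _ _ _) _.
    rewrite big_seq [leRHS]big_seq; apply: ler_sum => b bN.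
    have b0 := box_neq0 bN; have kab := k_ge0 a0 b0.
    have x0 := xm.1 b bN; have y0 := ym.1 b bN.
    rewrite -mulrBr normrM (ger0_norm kab).
    have [bM|bM] := boolP (b \in box M).
      rewrite mul1r; apply: (@le_trans _ _ (k a b * eta)).
        by rewrite ler_wpM2l // xy.
      by rewrite lerDl mulr_ge0 ?(ltW e'0) // addr_ge0 // mulr_ge0.
    rewrite !mul0r add0r -mulrDr mulrA; apply: ler_pM => //; first exact: kM.
    by rewrite ler_norml; apply/andP; split; lra.
  rewrite big_split /= -mulr_suml -mulr_sumr big_split /=.
  apply: lerD; last first.
    by rewrite ler_wpM2l ?(ltW e'0) // lerD ?xm.2 ?ym.2.
  rewrite ler_wpM2r ?(ltW eta0) // (bigID (mem (box M))) /=.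
  rewrite [X in _ + X]big1 ?addr0; last by move=> b /negPf ->; rewrite mul0r.
  rewrite sum_box_sub // /kappa big_seq [leRHS]big_seq; apply: ler_sum => b bM.
  by rewrite bM mul1r.
have gain_le : `|gain K x a - gain K y a| <= G * (2 * m * eta).
  rewrite !(gain_box _ _ aM) -sumrB mulr_suml.
  apply: le_trans (ler_norm_sum _ _ _) _.
  rewrite big_seq [leRHS]big_seq; apply: ler_sum => b bM.
  rewrite -sumrB mulr_suml; apply: le_trans (ler_norm_sum _ _ _) _.
  rewrite big_seq [leRHS]big_seq; apply: ler_sum => c cM.
  have k0 := kpos b c bM cM.
  have me0 : 0 <= 2 * m * eta by apply: mulr_ge0; [exact: mulr_ge0 | exact: ltW].
  case: eqP => [bca|_]; last by rewrite !mul0r subrr normr0 mulr_ge0.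
  rewrite !mul1r -!mulrA -mulrBr normrM (ger0_norm k0) ler_wpM2l //.
  have -> : x b * x c - y b * y c = x b * (x c - y c) + (x b - y b) * y c by ring.
  apply: le_trans (ler_normD _ _) _; rewrite !normrM.
  have /andP[xb0 xbm] := xB b bM; have /andP[yc0 ycm] := yB c cM.
  rewrite (ger0_norm xb0) (ger0_norm yc0).
  have h1 : x b * `|x c - y c| <= m * eta by rewrite ler_pM ?xy.
  have h2 : `|x b - y b| * y c <= eta * m by rewrite ler_pM ?xy.
  lra.
have /andP[xa0 xam] := xB a aM.
have outy0 := outflow_ge0 ym.1 a0; have outy1 := outflow_le kA A0 ym.
have loss_le : `|x a * outflow N x a - y a * outflow N y a| <=
    m * (kappa * eta + e' * (m + m)) + eta * (A a * m).
  have -> : x a * outflow N x a - y a * outflow N y a =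
    x a * (outflow N x a - outflow N y a) + (x a - y a) * outflow N y a by ring.
  apply: le_trans (ler_normD _ _) _; rewrite !normrM.
  rewrite (ger0_norm xa0) (ger0_norm outy0).
  by apply: lerD; rewrite ler_pM ?xy.
have eta_T : T * eta <= e / 2.
  have -> : e / 2 = (T + 1) * eta by rewrite /eta; field; apply/eqP; lra.
  by rewrite ler_wpM2r ?(ltW eta0) //; lra.
have e'_m : e' * (m * m) <= e / 4.
  have -> : e / 4 = e' * (m * m + 1) by rewrite /e'; field; apply/eqP; lra.
  by rewrite ler_wpM2l ?(ltW e'0) //; lra.
have -> : rate N x a - rate N y a = 2^-1 * (gain K x a - gain K y a)
   - (x a * outflow N x a - y a * outflow N y a) by rewrite /rate; ring.
apply: le_trans (ler_normB _ _) _; rewrite normrM.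
rewrite (@ger0_norm _ 2^-1) ?invr_ge0 //.
have -> : e = e / 2 + 2 * (e / 4) by field.
apply: (@le_trans _ _ (T * eta + 2 * (e' * (m * m)))); last by lra.
apply: (@le_trans _ _ (2^-1 * (G * (2 * m * eta)) +
   (m * (kappa * eta + e' * (m + m)) + eta * (A a * m)))).
  by apply: lerD => //; rewrite ler_wpM2l ?invr_ge0.
by rewrite le_eqVlt; apply/orP; left; apply/eqP; rewrite /T; field.
Qed.

End Rate.

(** * The Euler scheme *)

Section Euler.
Context {R : realType} {d : nat} (K : 'rV[R]_d -> 'rV[R]_d -> R).
Local Notation k a b := (K (vec a) (vec b)).
Implicit Types (a b c : 'rV[nat]_d) (N M i p : nat).

Context (k_ge0 : forall a b, multi_index a -> multi_index b -> 0 <= k a b).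
Context (k_sym : forall a b, multi_index a -> multi_index b -> k a b = k b a).
Context (k_sublinear : forall a (e : R), multi_index a -> 0 < e ->
  exists M, forall b, multi_index b -> (M < mi_deg b)%N ->
    k a b <= e * (mi_deg b)%:R).
Context (n0 : 'rV[nat]_d -> R) (m : R).
Context (n0_state : forall N, state m N n0).

(** On states of mass at most m, every outflow in the box is at most 1 / step;
the summand N + 1 makes the step tend to 0. *)
Definition step N : R :=
  (N.+1%:R + \sum_(a <- box N) \sum_(b <- box N) k a b * m)^-1.

Fixpoint euler N i : 'rV[nat]_d -> R :=
  if i is j.+1 then fun a => euler N j a + step N * rate K N (euler N j) a
  else n0.

Lemma mass_ge0 : 0 <= m.
Proof.
apply: le_trans (n0_state 0).2; rewrite big_seq sumr_ge0 // => b bN.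
by rewrite mulr_ge0 // (n0_state 0).1.
Qed.

Let k_box0 N a b : a \in box N -> b \in box N -> 0 <= k a b * m.
Proof.
move=> aN bN; rewrite mulr_ge0 ?mass_ge0 // k_ge0 //.
  exact: box_neq0 aN.
exact: box_neq0 bN.
Qed.

Lemma step_inv_gt0 N :
  0 < N.+1%:R + \sum_(a <- box N) \sum_(b <- box N) k a b * m.
Proof.
rewrite ltr_pwDl // big_seq sumr_ge0 // => a aN.
by rewrite big_seq sumr_ge0 // => b bN; exact: k_box0 bN.
Qed.

Lemma step_gt0 N : 0 < step N.
Proof. by rewrite invr_gt0 step_inv_gt0. Qed.

Lemma step_le N : step N <= N.+1%:R^-1.
Proof.
rewrite lef_pV2 ?posrE ?step_inv_gt0 // lerDl big_seq sumr_ge0 // => a aN.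
by rewrite big_seq sumr_ge0 // => b bN; exact: k_box0 bN.
Qed.

(** This is the condition under which an explicit Euler step cannot remove
more than the density that is present. *)
Lemma step_outflow_le1 N u a : state m N u -> a \in box N ->
  step N * outflow K N u a <= 1.
Proof.
move=> um aN; rewrite mulrC ler_pdivrMr ?step_inv_gt0 // mul1r.
apply: (@le_trans _ _ (\sum_(b <- box N) k a b * m)).
  rewrite /outflow big_seq [leRHS]big_seq; apply: ler_sum => b bN.
  have /andP[_ ubm] := state_bound um bN.
  by rewrite ler_wpM2l // k_ge0 //; [exact: box_neq0 aN | exact: box_neq0 bN].
apply: ler_wpDl => //.
apply: (@le_sum_box _ _ N (fun a => \sum_(b <- box N) k a b * m)) => // c cN.
by rewrite big_seq sumr_ge0 // => b bN; exact: k_box0 bN.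
Qed.

Lemma euler_moment_step N i (w : 'rV[nat]_d -> R) :
  (forall a b, w (a + b) = w a + w b) -> (forall a, 0 <= w a) ->
  (forall b, b \in box N -> 0 <= euler N i b) ->
  \sum_(a <- box N) w a * euler N i.+1 a <= \sum_(a <- box N) w a * euler N i a.
Proof.
move=> wD w0 u0 /=; under eq_bigr => a _ do rewrite mulrDr mulrCA.
rewrite big_split /= -mulr_sumr gerDl.
by rewrite pmulr_rle0 ?step_gt0 // moment_rate_le0.
Qed.

Lemma euler_state N i : state m N (euler N i).
Proof.
elim: i => [|i IH]; first exact: n0_state.
split=> [a aN|].
  have a0 := IH.1 a aN; have g0 := gain_ge0 k_ge0 IH.1 aN.
  have o1 := step_outflow_le1 IH aN; have h0 := ltW (step_gt0 N).
  rewrite /= /rate; set o := outflow _ _ _ _ in o1 *; set g := gain _ _ _ in g0 *.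
  set u := euler N i a in a0 *; set h := step N in o1 h0 *.
  have -> : u + h * (2^-1 * g - u * o) = u * (1 - h * o) + 2^-1 * (h * g) by ring.
  apply: addr_ge0; first by rewrite mulr_ge0 // subr_ge0.
  by rewrite mulr_ge0 ?invr_ge0 // mulr_ge0.
apply: le_trans IH.2; apply: (@euler_moment_step _ _ (fun a => (mi_deg a)%:R)).
- by move=> a b; rewrite degD natrD.
- by [].
- exact: IH.1.
Qed.

Lemma euler_moment_le N i (w : 'rV[nat]_d -> R) :
  (forall a b, w (a + b) = w a + w b) -> (forall a, 0 <= w a) ->
  \sum_(a <- box N) w a * euler N i a <= \sum_(a <- box N) w a * n0 a.
Proof.
move=> wD w0; elim: i => // i; apply: le_trans.
by apply: euler_moment_step => //; exact: (euler_state N i).1.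
Qed.

Lemma euler_lipschitz : exists C : 'rV[nat]_d -> R, forall a, 0 <= C a /\
  forall N i p, a \in box N ->
    `|euler N (i + p) a - euler N i a| <= C a * (p%:R * step N).
Proof.
have [C CP] := rate_bounded k_ge0 k_sublinear m.
exists (fun a => `|C a|) => a; split=> // N i p aN; elim: p => [|p IH].
  by rewrite addn0 subrr normr0 mul0r mulr0.
rewrite addnS /= addrAC -natr1 mulrDl mul1r mulrDr.
apply: le_trans (ler_normD _ _) _; apply: lerD; first exact: IH.
rewrite normrM (gtr0_norm (step_gt0 N)) mulrC ler_wpM2r ?(ltW (step_gt0 N)) //.
by apply: le_trans (CP _ _ _ (euler_state N _) aN) (ler_norm _).
Qed.

(** In a short time the finitely many densities that matter for the rate of a
hardly move, by the Lipschitz bound; hence neither does the rate. *)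
Lemma euler_rate_slow (e : R) a : multi_index a -> 0 < e ->
  exists M (delta : R), 0 < delta /\ forall N i p, (M <= N)%N ->
    p%:R * step N <= delta ->
    `|rate K N (euler N (i + p)) a - rate K N (euler N i) a| <= e.
Proof.
move=> a0 e0; have [C CP] := euler_lipschitz.
have [M [eta [eta0 Meta]]] :=
  rate_equicontinuous k_ge0 k_sublinear a0 mass_ge0 e0.
pose D := 1 + \sum_(b <- box M) C b.
have D0 : 0 < D.
  by rewrite ltr_pwDl // sumr_ge0 // => b _; exact: (CP b).1.
exists M, (eta / D); split=> [|N i p MN ph]; first exact: divr_gt0.
apply: Meta => //; [exact: euler_state | exact: euler_state | move=> b bM].
have [Cb0 Cb] := CP b; apply: le_trans (Cb _ _ _ (box_le MN bM)) _.
have ph0 : 0 <= p%:R * step N by rewrite mulr_ge0 // ltW ?step_gt0.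
apply: (@le_trans _ _ (D * (p%:R * step N))).
  rewrite ler_wpM2r // ler_wpDl //.
  by apply: (@le_sum_box _ _ M C) => // c _; exact: (CP c).1.
by rewrite mulrC -ler_pdivlMr.
Qed.

(** Summing the Euler steps, each of which moves along a rate that is e-close
to the initial one. *)
Lemma euler_taylor (e : R) a : multi_index a -> 0 < e ->
  exists M (delta : R), 0 < delta /\ forall N i p, (M <= N)%N ->
    p%:R * step N <= delta ->
    `|euler N (i + p) a - euler N i a - p%:R * step N * rate K N (euler N i) a|
      <= e * (p%:R * step N).
Proof.
move=> a0 e0; have [M [delta [delta0 slow]]] := euler_rate_slow a0 e0.
exists M, delta; split=> // N i p MN; elim: p => [_|p IH ph].
  by rewrite addn0 !mul0r mulr0 subrr subr0 normr0.
have h0 := ltW (step_gt0 N).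
have ph' : p%:R * step N <= delta.
  by apply: le_trans ph; rewrite ler_wpM2r // ler_nat.
rewrite addnS /= -natr1.
set h := step N in h0 *; set r := rate K N (euler N i) a.
set r' := rate K N (euler N (i + p)) a.
have -> : euler N (i + p) a + h * r' - euler N i a - (p%:R + 1) * h * r =
  (euler N (i + p) a - euler N i a - p%:R * h * r) + h * (r' - r) by ring.
apply: le_trans (ler_normD _ _) _.
rewrite mulrDl mul1r mulrDr; apply: lerD; first exact: IH.
by rewrite normrM (ger0_norm h0) mulrC ler_wpM2r // slow.
Qed.

End Euler.

(** * Passage to the limit *)

Section Limit.
Context {R : realType}.

(** The values have a cluster point in [A, B] by compactness, and an
ultrafilter converges to each of its cluster points. *)
Lemma ultra_cvg (U : set_system nat) (f : nat -> R) (A B : R) : UltraFilter U ->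
  (\forall N \near U, A <= f N <= B) -> cvg (f N @[N --> U]).
Proof.
move=> UU fAB.
have [|p [_ clp]] := @segment_compact R A B (f N @[N --> U]) _.
  by apply: filterS fAB => N; rewrite /= in_itv.
apply/cvg_ex; exists p => V Vp.
have [//|UVc] := in_ultra_setVsetC (f @^-1` V) UU.
by have [x []] := clp (~` V) V UVc Vp.
Qed.

Context {d : nat} (K : 'rV[R]_d -> 'rV[R]_d -> R).
Local Notation k a b := (K (vec a) (vec b)).
Implicit Types (a b c : 'rV[nat]_d) (N M i p : nat).

Context (k_ge0 : forall a b, multi_index a -> multi_index b -> 0 <= k a b).
Context (k_sym : forall a b, multi_index a -> multi_index b -> k a b = k b a).
Context (k_sublinear : forall a (e : R), multi_index a -> 0 < e ->
  exists M, forall b, multi_index b -> (M < mi_deg b)%N ->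
    k a b <= e * (mi_deg b)%:R).

(** The truncated outflows increase with N and are bounded by the mass. *)
Lemma loss_cvg (m : R) u a : multi_index a -> (forall N, state m N u) ->
  (loss K u a < +oo)%E /\ outflow K N u a @[N --> \oo] --> fine (loss K u a).
Proof.
move=> a0 um; have [A /(_ a a0)[A0 kA]] := linear_bound k_ge0 k_sublinear.
have u0 b : multi_index b -> 0 <= u b.
  by move=> b0; apply: (um (mi_deg b)).1; exact: box_deg.
have ku0 b : multi_index b -> 0 <= k a b * u b.
  by move=> b0; rewrite mulr_ge0 ?k_ge0 ?u0.
have out_le N : outflow K N u a <= A a * m by exact: outflow_le.
have out_incr : {homo (fun N => outflow K N u a) : M N / (M <= N)%N >-> M <= N}.
  move=> M N MN; apply: (@sum_box_le _ _ M N (fun b => k a b * u b) MN).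
  by move=> b /box_neq0/ku0.
have out_ub : has_ubound (range (fun N => outflow K N u a)).
  by exists (A a * m) => _ [N _ <-].
have out_cvg := nondecreasing_cvgn out_incr out_ub.
suff -> : loss K u a = (sup (range (fun N => outflow K N u a)))%:E.
  by split; [exact: ltry | exact: out_cvg].
apply/eqP; rewrite eq_le; apply/andP; split.
  apply: esum_le_box => // N; rewrite lee_fin.
  by apply: (ub_le_sup out_ub); exists N.
have loss_fin : loss K u a \is a fin_num.
  rewrite ge0_fin_numE; last by apply: esum_ge0 => b b0; rewrite lee_fin ku0.
  by apply: (@le_lt_trans _ _ (A a * m)%:E); [exact: esum_le_box | exact: ltry].
rewrite -(fineK loss_fin) lee_fin; apply: ge_sup.
  by exists (outflow K 0 u a), 0%N.
by move=> _ [N _ <-]; rewrite -lee_fin fineK //; exact: box_le_esum.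
Qed.

Context (n0 : 'rV[nat]_d -> R) (m : R).
Context (n0_state : forall N, state m N n0).
Context (U : set_system nat) (UU : UltraFilter U) (Uoo : \oo `<=` U).

Local Notation h N := (step K m N).
Local Notation u N i := (euler K n0 m N i).

Let UP : ProperFilter U := ultra_proper.
Local Existing Instance UP.

Lemma step_cvg0 : h N @[N --> \oo] --> 0.
Proof.
apply: (squeeze_cvgr _ (cvg_cst 0) (@cvg_harmonic R)).
apply: nearW => N; apply/andP; split; last exact: step_le n0_state N.
by apply: ltW; exact: step_gt0 n0_state N.
Qed.

Definition steps_by N (t : R) : nat := Num.trunc (t / h N).

Lemma steps_by_cvg (t : R) : 0 <= t -> (steps_by N t)%:R * h N @[N --> U] --> t.
Proof.
move=> t0; apply: (@cvg_trans _ ((steps_by N t)%:R * h N @[N --> \oo])).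
  by move=> V; exact: Uoo.
apply/cvgrPdist_le => e e0.
have : \forall N \near \oo, h N < e by exact: (cvgr_lt _ step_cvg0).
apply: filterS => N hNe; have hN := step_gt0 k_ge0 n0_state N.
have /andP[] := truncn_itv (divr_ge0 t0 (ltW hN)).
rewrite -/(steps_by N t) ler_pdivlMr // ltr_pdivrMr // -natr1 mulrDl mul1r => c1 c2.
by rewrite ger0_norm ?subr_ge0 // ltW // ltrBlDl (lt_trans c2) // ltrD2l.
Qed.

Lemma steps_by_le N (s t : R) : s <= t -> (steps_by N s <= steps_by N t)%N.
Proof.
move=> st; apply: le_truncn; rewrite ler_pM2r // invr_gt0.
exact: step_gt0 n0_state N.
Qed.

(** The ultrafilter provides the limit for the uncountably many t at once. *)
Definition limit a (t : R) : R := lim (u N (steps_by N t) a @[N --> U]).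

Lemma near_box M : \forall N \near U, (M <= N)%N.
Proof. by apply: Uoo; exact: nbhs_infty_ge. Qed.

Lemma limit_cvg a (t : R) : multi_index a ->
  u N (steps_by N t) a @[N --> U] --> limit a t.
Proof.
move=> a0; apply: (@ultra_cvg _ _ 0 m) => //.
apply: filterS (near_box (mi_deg a)) => N aN.
by apply: state_bound (euler_state k_ge0 k_sym n0_state N _) _; exact: box_deg.
Qed.

Lemma limit_ge0 a (t : R) : multi_index a -> 0 <= limit a t.
Proof.
move=> a0; apply: (cvgr_to_ge (limit_cvg (t := t) a0)).
apply: filterS (near_box (mi_deg a)) => N aN.
by apply: (euler_state k_ge0 k_sym n0_state N _).1; exact: box_deg.
Qed.

Lemma limit0 a : multi_index a -> limit a 0 = n0 a.
Proof.
move=> a0; apply: (@cvg_lim R) => //; rewrite /steps_by.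
under eq_fun do rewrite mul0r truncn0 /=.
exact: cvg_cst.
Qed.

(** Partial sums over a fixed box converge, and those of the Euler states are
bounded by the initial moment as soon as N >= M. *)
Lemma limit_moment M (t C : R) (w : 'rV[nat]_d -> R) :
  (forall a b, w (a + b) = w a + w b) -> (forall a, 0 <= w a) ->
  (forall N, \sum_(a <- box N) w a * n0 a <= C) ->
  \sum_(a <- box M) w a * limit a t <= C.
Proof.
move=> wD w0 wC.
have sum_cvg : \sum_(a <- box M | a \in box M) w a * u N (steps_by N t) a @[N --> U]
    --> \sum_(a <- box M | a \in box M) w a * limit a t.
  apply: cvg_big => [|a aM]; first exact: add_continuous.
  by apply: cvgMr; apply: limit_cvg; exact: box_neq0 aM.
rewrite big_seq; apply: (cvgr_to_le sum_cvg).
apply: filterS (near_box M) => N MN; apply: le_trans (wC N).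
apply: le_trans (euler_moment_le k_ge0 k_sym n0_state N (steps_by N t) wD w0).
rewrite -big_seq.
apply: (@sum_box_le _ _ M N (fun a => w a * u N (steps_by N t) a)) => // a aN.
by rewrite mulr_ge0 // (euler_state k_ge0 k_sym n0_state N _).1.
Qed.

Lemma limit_state M (t : R) : state m M (limit ^~ t).
Proof.
split=> [b /box_neq0|]; first exact: limit_ge0.
apply: (@limit_moment M t m (fun a => (mi_deg a)%:R)) => //.
- by move=> a b; rewrite degD natrD.
- by move=> N; exact: (n0_state N).2.
Qed.

Definition limit_rate a (t : R) : R :=
  2^-1 * gain K (limit ^~ t) a - limit a t * fine (loss K (limit ^~ t) a).

(** Two limits at once: the truncation of the loss series is removed, and the
Euler state is replaced by its pointwise limit. Equicontinuity of the rates
allows to treat these separately, the second one at fixed N. *)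
Lemma limit_rate_cvg a (t : R) : multi_index a ->
  rate K N (u N (steps_by N t)) a @[N --> U] --> limit_rate a t.
Proof.
move=> a0.
have lim_cvg : rate K N (limit ^~ t) a @[N --> U] --> limit_rate a t.
  apply: (@cvg_trans _ (rate K N (limit ^~ t) a @[N --> \oo])).
    by move=> V; exact: Uoo.
  apply: cvgB; first exact: cvg_cst.
  by apply: cvgMr; exact: (loss_cvg a0 (fun M => limit_state M t)).2.
apply: (cvg_sub0 _ lim_cvg); apply/cvgrPdist_le => e e0.
have [M [eta [eta0 Meta]]] := rate_equicontinuous k_ge0 k_sublinear a0
  (mass_ge0 n0_state) e0.
have near_eta : \forall N \near U,
    forall b, b \in box M -> `|u N (steps_by N t) b - limit b t| <= eta.
  have near1 b : b \in box M -> \forall N \near U,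
      `|u N (steps_by N t) b - limit b t| <= eta.
    move=> bM; have /cvgrPdist_le/(_ _ eta0) := limit_cvg (t := t) (box_neq0 bM).
    by apply: filterS => N; rewrite distrC.
  elim: (box M) near1 => [_|c s IH cs]; first by apply: nearW => N b.
  have c1 := cs c (mem_head _ _).
  have s1 := IH (fun b bs => cs b (mem_behead (s := c :: s) bs)).
  by apply: filterS2 c1 s1 => N c1 s1 b; rewrite inE => /predU1P[->|/s1].
apply: filterS2 near_eta (near_box M) => N Neta MN.
rewrite sub0r normrN; apply: Meta => //; last exact: limit_state.
exact: euler_state.
Qed.

Lemma near_elapsed (s t delta : R) : 0 <= s -> s <= t -> t - s < delta ->
  ((steps_by N t - steps_by N s)%N%:R * h N @[N --> U] --> t - s) /\
  \forall N \near U, (steps_by N t - steps_by N s)%N%:R * h N <= delta.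
Proof.
move=> s0 st ts; have c : (steps_by N t - steps_by N s)%N%:R * h N @[N --> U] --> t - s.
  under eq_fun => N do rewrite natrB ?steps_by_le // mulrBl.
  by apply: cvgB; apply: steps_by_cvg => //; exact: le_trans st.
by split=> //; exact: (cvgr_le _ c).
Qed.

(** No estimate depends on s, so that the modulus is uniform on the whole
half-line. *)
Lemma limit_rate_uniform a (e : R) : multi_index a -> 0 < e ->
  exists2 delta : R, 0 < delta & forall s t : R, 0 <= s -> s <= t ->
    t - s < delta -> `|limit_rate a t - limit_rate a s| <= e.
Proof.
move=> a0 e0; have [M [delta [delta0 slow]]] :=
  euler_rate_slow k_ge0 k_sym k_sublinear n0_state a0 e0.
exists delta => // s t s0 st ts; have [_ near_d] := near_elapsed s0 st ts.
have c : `|rate K N (u N (steps_by N t)) a - rate K N (u N (steps_by N s)) a|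
    @[N --> U] --> `|limit_rate a t - limit_rate a s|.
  by apply: cvg_norm; apply: cvgB; exact: limit_rate_cvg.
apply: (cvgr_to_le c); apply: filterS2 near_d (near_box M) => N Nd MN.
by have := slow N (steps_by N s) _ MN Nd; rewrite subnKC ?steps_by_le.
Qed.

Lemma limit_taylor_right a (e : R) : multi_index a -> 0 < e ->
  exists2 delta : R, 0 < delta & forall s t : R, 0 <= s -> s <= t ->
    t - s < delta ->
    `|limit a t - limit a s - (t - s) * limit_rate a s| <= e * (t - s).
Proof.
move=> a0 e0; have [M [delta [delta0 taylor]]] :=
  euler_taylor k_ge0 k_sym k_sublinear n0_state a0 e0.
exists delta => // s t s0 st ts; have [c_el near_d] := near_elapsed s0 st ts.
have c : `|u N (steps_by N t) a - u N (steps_by N s) a -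
      (steps_by N t - steps_by N s)%N%:R * h N * rate K N (u N (steps_by N s)) a|
    @[N --> U] --> `|limit a t - limit a s - (t - s) * limit_rate a s|.
  apply: cvg_norm; apply: cvgB; first by apply: cvgB; exact: limit_cvg.
  by apply: cvgM => //; exact: limit_rate_cvg.
have c' : e * ((steps_by N t - steps_by N s)%N%:R * h N) @[N --> U] --> e * (t - s).
  exact: cvgMr.
apply: (ler_cvg_to c c'); apply: filterS2 near_d (near_box M) => N Nd MN.
by have := taylor N (steps_by N s) _ MN Nd; rewrite subnKC ?steps_by_le.
Qed.

(** For t < s the expansion at t is transported to s, which costs the
variation of the rate between the two times. *)
Lemma limit_taylor a (e : R) : multi_index a -> 0 < e ->
  exists2 delta : R, 0 < delta & forall s t : R, 0 <= s -> 0 <= t ->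
    `|t - s| < delta ->
    `|limit a t - limit a s - (t - s) * limit_rate a s| <= e * `|t - s|.
Proof.
move=> a0 e0; have e20 : 0 < e / 2 by lra.
have [d1 d10 D1] := limit_taylor_right a0 e20.
have [d2 d20 D2] := limit_rate_uniform a0 e20.
exists (Num.min d1 d2) => [|s t s0 t0]; first by rewrite lt_min d10.
rewrite lt_min => /andP[].
have [st|/ltW ts] := leP s t.
  rewrite ger0_norm ?subr_ge0 // => ts _; apply: le_trans (D1 s t s0 st ts) _.
  by rewrite ler_wpM2r ?subr_ge0 //; lra.
rewrite distrC ger0_norm ?subr_ge0 // => st1 st2.
have h1 := D1 t s t0 ts st1; have h2 := D2 t s t0 ts st2.
have -> : limit a t - limit a s - (t - s) * limit_rate a s =
  - (limit a s - limit a t - (s - t) * limit_rate a t) +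
  (s - t) * (limit_rate a s - limit_rate a t) by ring.
apply: le_trans (ler_normD _ _) _; rewrite normrN normrM.
rewrite (ger0_norm (_ : 0 <= s - t)) ?subr_ge0 //.
have -> : e * (s - t) = e / 2 * (s - t) + (s - t) * (e / 2) by field.
by apply: lerD => //; rewrite ler_wpM2l ?subr_ge0.
Qed.

Lemma limit_rate_continuous a : multi_index a ->
  {within `[0, +oo[, continuous (limit_rate a)}.
Proof.
move=> a0; apply/subspace_continuousP => s; rewrite /= in_itv /= andbT => s0.
apply/cvgrPdist_le => e e0; have [delta d0 D] := limit_rate_uniform a0 e0.
rewrite near_withinE; near=> t; rewrite /= in_itv /= andbT => t0.
have std : `|s - t| < delta by near: t; exact: cvgr_dist_lt.
have [st|/ltW ts] := leP s t.
  by rewrite distrC D // (le_lt_trans _ std) // distrC ler_norm.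
by rewrite D // (le_lt_trans _ std) // ler_norm.
Unshelve. all: by end_near. Qed.

Lemma limit_derive a (s : R) : multi_index a -> 0 <= s ->
  has_derive_within `[0, +oo[ (limit a) s (limit_rate a s).
Proof.
move=> a0 s0; apply/cvgrPdist_le => e e0.
have [delta d0 D] := limit_taylor a0 e0.
rewrite near_withinE; near=> t; rewrite /= in_itv /= andbT => t0.
have std : `|s - t| < delta.
  by near: t; apply: cvg_within; exact: (@cvgr_dist_lt _ _ _ (nbhs s)).
have ts : t - s != 0.
  by rewrite subr_eq0; near: t; exact: nbhs_dnbhs_neq.
have -> : limit_rate a s - (limit a t - limit a s) / (t - s) =
  - ((limit a t - limit a s - (t - s) * limit_rate a s) / (t - s)) by field.
rewrite normrN normrM normfV ler_pdivrMr ?normr_gt0 //.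
by apply: D => //; rewrite distrC.
Unshelve. all: by end_near. Qed.

Lemma limit_solution : strong_solution K limit.
Proof.
move=> a a0; split=> [t _|]; first exact: limit_ge0.
exists (limit_rate a); split=> [|t t0]; first exact: limit_rate_continuous.
have [loss_fin _] := loss_cvg a0 (fun M => limit_state M t).
split=> //; first exact: limit_derive.
rewrite /limit_rate EFinB; congr (_ - _)%E.
rewrite EFinM fineK // ge0_fin_numE //.
apply: esum_ge0 => b b0.
by rewrite lee_fin mulr_ge0 ?k_ge0 ?limit_ge0.
Qed.

End Limit.

(** * Power-law kernels *)

Section PowerKernel.
Context {R : realType} {d : nat} (K : 'rV[R]_d -> 'rV[R]_d -> R).
Context (c beta : R) (gamma lambda : R * R).
Implicit Types (a b : 'rV[nat]_d).

(** Swapping the arguments so that the larger vector comes first, the bound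
reads K(b,a) <= B |b|^mu with mu = gamma_2 + lambda_2 < 1 and B depending on a;
and B |b|^mu <= e |b| as soon as |b|^(1 - mu) >= B / e. *)
Lemma kernel_bound_sublinear : 0 < c -> gamma.2 + lambda.2 < 1 ->
  (forall x y, orthant x -> orthant y -> K x y = K y x) ->
  kernel_bound c beta gamma lambda K ->
  forall a (e : R), multi_index a -> 0 < e ->
  exists M, forall b, multi_index b -> (M < mi_deg b)%N ->
    K (vec a) (vec b) <= e * (mi_deg b)%:R.
Proof.
move=> c0 mu1 K_sym K_le a e a0 e0.
set mu := gamma.2 + lambda.2 in mu1.
pose B := c * (mi_deg a)%:R `^ (- lambda.2).
have B0 : 0 <= B by rewrite mulr_ge0 ?powR_ge0 // ltW.
pose X := (B / e) `^ (1 - mu)^-1.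
exists (maxn (mi_deg a) (Num.trunc X)) => b b0.
rewrite gtn_max => /andP[ab Xb].
have oa := @orthant_vec R _ _ a0; have ob := @orthant_vec R _ _ b0.
have ab_norm : l1norm (vec a : 'rV[R]_d) <= l1norm (vec b).
  by rewrite !l1norm_vec ler_nat ltnW.
have Kba : K (vec b) (vec a) <= B * (mi_deg b)%:R `^ mu.
  have [_ _] := K_le _ _ ob oa ab_norm.
  rewrite !l1norm_vec !ler1n !deg_gt0 // => /(_ isT isT)/le_trans; apply.
  by rewrite mulrCA mulrC.
rewrite K_sym //; apply: le_trans Kba _.
set q : R := (mi_deg b)%:R.
have q_gt0 : 0 < q by rewrite ltr0n deg_gt0.
have Xq : X <= q.
  have X0 : 0 <= X by exact: powR_ge0.
  have /andP[_ /ltW XS] := truncn_itv X0.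
  by apply: le_trans XS _; rewrite ler_nat.
have Bq : B / e <= q `^ (1 - mu).
  have -> : B / e = X `^ (1 - mu).
    by rewrite /X -powRrM mulVf ?powRr1 ?divr_ge0 ?(ltW e0) // subr_eq0 gt_eqF.
  apply: ge0_ler_powR => //; rewrite ?subr_ge0 ?(ltW mu1) //.
    by rewrite nnegrE powR_ge0.
  by rewrite nnegrE ltW.
have qE : q = q `^ (1 - mu) * q `^ mu.
  by rewrite -powRD ?subrK ?powRr1 ?(ltW q_gt0) // gt_eqF // implybT.
rewrite [in leRHS]qE mulrA ler_wpM2r ?powR_ge0 //.
by rewrite mulrC -ler_pdivrMr.
Qed.

(** An index with |a| <= 1 has |a| = 1, so the first case of the weight only
takes the value 1; in the second case the exponent is less than 1. *)
Lemma weight_le : gamma.1 + lambda.1 < 1 -> gamma.2 + lambda.2 < 1 ->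
  forall a, multi_index a ->
    weight beta gamma lambda (vec a) <= (mi_deg a)%:R.
Proof.
move=> mu1 mu2 a a0; have a1 : 1 <= (mi_deg a)%:R :> R by rewrite ler1n deg_gt0.
rewrite /weight l1norm_vec; case: ifP => [a_le1|_].
  have -> : (mi_deg a)%:R = 1 :> R by apply/eqP; rewrite eq_le a_le1.
  by rewrite powR1.
by apply: ler1_powR => //; rewrite ge_max !ltW.
Qed.

End PowerKernel.

Theorem corollary1p2 (R : realType) (d : nat) (d_ge1 : (1 <= d)%N)
  (K : 'rV[R]_d -> 'rV[R]_d -> R)
  (K_ge0 : forall x y, orthant x -> orthant y -> 0 <= K x y)
  (K_cont : {within orthant `*` orthant,
    continuous (fun p : 'rV[R]_d * 'rV[R]_d => K p.1 p.2)})
  (K_sym : forall x y, orthant x -> orthant y -> K x y = K y x)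
  (c2 beta : R) (gamma lambda : R * R)
  (c2_gt0 : 0 < c2)
  (exp1 : - lambda.1 <= gamma.1 + lambda.1 /\ gamma.1 + lambda.1 < 1)
  (exp2 : - lambda.2 <= gamma.2 + lambda.2 /\ gamma.2 + lambda.2 < 1)
  (K_le : kernel_bound c2 beta gamma lambda K)
  (n0 : 'rV[nat]_d -> R)
  (n0_ge0 : forall a, multi_index a -> 0 <= n0 a)
  (n0_mass :
    (\esum_(a in multi_index) (l1norm (vec a) * n0 a)%:E < +oo :> \bar R)%E) :
  exists n : 'rV[nat]_d -> R -> R,
    [/\ strong_solution K n,
        forall a, multi_index a -> n a 0 = n0 a,
        forall (t : R) (j : 'I_d), 0 <= t ->
          (\esum_(a in multi_index) ((a 0 j)%:R * n a t)%:E
           <= \esum_(a in multi_index) ((a 0 j)%:R * n0 a)%:E)%E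
      & forall t : R, 0 <= t ->
          (ereal_sup [set \esum_(a in multi_index)
                            (weight beta gamma lambda (vec a) * n a s)%:E
                     | s in `[0%R, t]] < +oo)%E].
Proof.
have k_ge0 a b (a0 : multi_index a) (b0 : multi_index b) :=
  K_ge0 _ _ (orthant_vec a0) (orthant_vec b0).
have k_sym a b (a0 : multi_index a) (b0 : multi_index b) :=
  K_sym _ _ (orthant_vec a0) (orthant_vec b0).
have k_sub := kernel_bound_sublinear c2_gt0 exp2.2 K_sym K_le.
set mass := (\esum_(a in _) _)%E in n0_mass.
have deg_n0_ge0 a : multi_index a -> 0 <= l1norm (vec a) * n0 a.
  by move=> a0; rewrite l1norm_vec mulr_ge0 ?n0_ge0.
have mass_fin : mass \is a fin_num.
  by rewrite ge0_fin_numE //; apply: esum_ge0 => a a0; rewrite lee_fin deg_n0_ge0.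
pose m := fine mass.
have n0_state N : state m N n0.
  split=> [b /box_neq0|]; first exact: n0_ge0.
  rewrite -lee_fin /m fineK //; under eq_bigr => a _ do rewrite -l1norm_vec.
  exact: (@box_le_esum _ _ N (fun a => l1norm (vec a) * n0 a)).
have [U [UU Uoo]] := ultraFilterLemma (eventually_filter : ProperFilter \oo).
pose n := limit K n0 m U.
have n_ge0 a t : multi_index a -> 0 <= n a t by exact: limit_ge0.
have n_moment := limit_moment k_ge0 k_sym n0_state UU Uoo.
exists n; split.
- exact: limit_solution.
- by move=> a a0; exact: limit0.
- move=> t j t0; apply: esum_le_box => [a a0|M]; first by rewrite mulr_ge0 ?n_ge0.
  have moment_ge N : ((\sum_(a <- box N) (a 0 j)%:R * n0 a)%:E <=
      \esum_(a in multi_index) ((a 0 j)%:R * n0 a)%:E)%E.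
    apply: (@box_le_esum _ _ N (fun a => (a 0 j)%:R * n0 a)) => a a0.
    by rewrite mulr_ge0 ?n0_ge0.
  case: (esum _ _) moment_ge => [C|_|/(_ 0%N)] //=; last by rewrite leey.
  move=> moment_le; rewrite lee_fin.
  apply: (n_moment M t C (fun a => (a 0 j)%:R)) => //.
    by move=> a b; rewrite mxE natrD.
- move=> t t0; apply: (@le_lt_trans _ _ mass) => //.
  apply: ge_ereal_sup => _ [s _ <-].
  apply: (@le_trans _ _ (\esum_(a in multi_index) ((mi_deg a)%:R * n a s)%:E)%E).
    apply: le_esum => a a0; rewrite lee_fin ler_wpM2r ?n_ge0 //.
    by apply: weight_le a0; [exact: exp1.2 | exact: exp2.2].
  rewrite -(fineK mass_fin); apply: esum_le_box => [a a0|M].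
    by rewrite mulr_ge0 ?n_ge0.
  by rewrite lee_fin; exact: (limit_state k_ge0 k_sym n0_state UU Uoo M s).2.
Qed.
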